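(* Let $\mathcal{K}$ and $\mathcal{H}$ be finite dimensional complex Hilbert spaces and let $\phi:\mathfrak{B}(\mathcal{K})\to\mathfrak{B}(\mathcal{H})$ be a positive linear map such that $\mathrm{rank}\,\phi(P)\leq 1$ for every one-dimensional (orthogonal) projection $P$ on $\mathcal{K}$. Then one of the following three conditions holds: (i) there exist a positive functional $\omega$ on $\mathfrak{B}(\mathcal{K})$ and a one-dimensional projection $Q$ on $\mathcal{H}$ such that $\phi(X)=\omega(X)Q$ for any $X\in\mathfrak{B}(\mathcal{K})$; (ii) there exists a linear operator $B\in\mathfrak{B}(\mathcal{K},\mathcal{H})$ such that $\phi(X)=BXB^*$ for any $X\in\mathfrak{B}(\mathcal{K})$; (iii) there exists a linear operator $C\in\mathfrak{B}(\mathcal{K},\mathcal{H})$ such that $\phi(X)=CX^{\mathrm T}C^*$ for any $X\in\mathfrak{B}(\mathcal{K})$.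
   Context: $\mathfrak{B}(\mathcal{K})$ denotes the bounded operators on $\mathcal{K}$ and $\mathfrak{B}(\mathcal{K},\mathcal{H})$ the bounded operators from $\mathcal{K}$ to $\mathcal{H}$. Inner products are linear in the second variable. A linear map $\phi:\mathfrak{B}(\mathcal{K})\to\mathfrak{B}(\mathcal{H})$ is positive if it maps positive operators to positive operators. Transposition: fix an antilinear involution $\xi\mapsto\overline{\xi}$ on $\mathcal{K}$ with $\overline{\overline{\xi}}=\xi$ and $\langle\overline{\xi},\overline{\eta}\rangle=\langle\eta,\xi\rangle$; the transpose of $X\in\mathfrak{B}(\mathcal{K})$ is the linear operator $X^{\mathrm T}$ defined by $X^{\mathrm T}\xi=\overline{X^*\overline{\xi}}$, $\xi\in\mathcal{K}$. *)

(* Defs.v *)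
From HB Require Import structures.
From mathcomp Require Import all_boot all_order all_algebra.
From mathcomp Require Import boolp classical_sets reals.
From mathcomp Require Import complex.

Set Implicit Arguments.
Unset Strict Implicit.
Unset Printing Implicit Defensive.

Import GRing.Theory Num.Theory.
Local Open Scope ring_scope.

(* A finite dimensional Hilbert space is a vectType with a form
   d : {dot _ for Num.conj}.  Such forms are linear in their FIRST variable, so
   the inner product <x, y>, linear in y, is d y x. *)

Section Operators.
Variable C : numClosedFieldType.
Implicit Types K H : vectType C.

(* <B y, x> = <y, A x> *)
Definition is_adjoint K H (dK : {dot K for Num.conj}) (dH : {dot H for Num.conj})
    (A : 'Hom(K, H)) (B : 'Hom(H, K)) : Prop :=
  forall x y, dK x (B y) = dH (A x) y.

(* The default value 0 is never used, see adjP *)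
Definition adj K H (dK : {dot K for Num.conj}) (dH : {dot H for Num.conj})
    (A : 'Hom(K, H)) : 'Hom(H, K) :=
  xget 0 [set B | is_adjoint dK dH A B]%classic.

Definition positive_op K (dK : {dot K for Num.conj}) (X : 'End(K)) : Prop :=
  forall x, 0 <= dK (X x) x.

Definition positive_map K H (dK : {dot K for Num.conj}) (dH : {dot H for Num.conj})
    (phi : {linear 'End(K) -> 'End(H)}) : Prop :=
  forall X, positive_op dK X -> positive_op dH (phi X).

Definition positive_functional K (dK : {dot K for Num.conj})
    (omega : {scalar 'End(K)}) : Prop :=
  forall X, positive_op dK X -> 0 <= omega X.

Definition rank K H (A : 'Hom(K, H)) : nat := \dim (limg A).

Definition projection K (dK : {dot K for Num.conj}) (P : 'End(K)) : Prop :=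
  (P \o P)%VF = P /\ adj dK dK P = P.

Definition one_dim_projection K (dK : {dot K for Num.conj}) (P : 'End(K)) : Prop :=
  projection dK P /\ rank P = 1%N.

Definition is_conjugation K (dK : {dot K for Num.conj})
    (J : {linear K -> K | Num.conj \; *:%R}) : Prop :=
  involutive J /\ forall x y, dK (J x) (J y) = dK y x.

Definition transpose K (dK : {dot K for Num.conj})
    (J : {linear K -> K | Num.conj \; *:%R}) (X : 'End(K)) : 'End(K) :=
  linfun (fun x => J (adj dK dK X (J x))).

Lemma dot_inj K (dK : {dot K for Num.conj}) (u v : K) :
  (forall x, dK u x = dK v x) -> u = v.
Proof.
move=> uv; apply/eqP; rewrite -subr_eq0 -(dnorm_eq0 dK).
by rewrite -[dK _ _]/(applyr dK (u - v) (u - v)) raddfB /= /applyr_head uv subrr eqxx.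
Qed.

Lemma dotC K (dK : {dot K for Num.conj}) (u v : K) : dK u v = Num.conj (dK v u).
Proof. by rewrite (hermC dK) expr0 mul1r. Qed.

Lemma is_adjoint_ex K H (dK : {dot K for Num.conj}) (dH : {dot H for Num.conj})
  (A : 'Hom(K, H)) : exists B, is_adjoint dK dH A B.
Proof.
pose n : nat := \dim {:K}; pose b := vbasis {:K}.
have coords x : x = \sum_(i < n) coord b i x *: b`_i.
  by apply: coord_vbasis; rewrite memvf.
pose T (x : K) : 'rV[C]_n := \row_i dK x b`_i.
have linT : linear T.
  by move=> a x y; apply/rowP=> i; rewrite !mxE linearPl.
pose S (y : H) : 'rV[C]_n := \row_i dH y (A b`_i).
have linS : linear S.
  by move=> a x y; apply/rowP=> i; rewrite !mxE linearPl.
pose TL : {linear K -> 'rV[C]_n} :=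
  HB.pack T (GRing.isLinear.Build _ _ _ _ T linT).
pose SL : {linear H -> 'rV[C]_n} :=
  HB.pack S (GRing.isLinear.Build _ _ _ _ S linS).
have kerT : lker (linfun TL) == 0%VS.
  apply/lker0P => u v; rewrite !lfunE /= => Tuv; apply: (dot_inj (dK := dK)) => x.
  rewrite (coords x) !linear_sumr; apply: eq_bigr => i _.
  by rewrite !linearZr_LR /=; congr (_ * _); move/rowP/(_ i): Tuv; rewrite !mxE.
have imT : limg (linfun TL) = fullv.
  apply/eqP; rewrite eqEdim subvf /= limg_dim_eq; last first.
    by rewrite (eqP kerT) capv0.
  by rewrite dimvf dim_matrix; change (1 * n <= n)%N; rewrite mul1n leqnn.
pose B := ((linfun TL)^-1 \o linfun SL)%VF.
exists B => x y.
have TB (i : 'I_n) : dK (B y) b`_i = dH y (A b`_i).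
  have : linfun TL (B y) = SL y.
    by rewrite /B comp_lfunE (lfunE SL) limg_lfunVK // imT memvf.
  by rewrite lfunE => /rowP/(_ i); rewrite !mxE.
rewrite (dotC dK) (dotC dH); congr (Num.conj _).
rewrite (coords x) (linear_sum A) !linear_sumr; apply: eq_bigr => i _.
have AZ c v : A (c *: v) = c *: A v by rewrite linearZ.
by rewrite /= AZ !linearZr_LR /= TB.
Qed.

Lemma adjP K H (dK : {dot K for Num.conj}) (dH : {dot H for Num.conj})
  (A : 'Hom(K, H)) : is_adjoint dK dH A (adj dK dH A).
Proof.
by have [B AB] := is_adjoint_ex dK dH A; exact: (xgetI 0 AB).
Qed.

Lemma adj_unique K H (dK : {dot K for Num.conj}) (dH : {dot H for Num.conj})
  (A : 'Hom(K, H)) (B : 'Hom(H, K)) : is_adjoint dK dH A B -> adj dK dH A = B.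
Proof.
move=> AB; apply/lfunP => y; apply: (dot_inj (dK := dK)) => x.
by rewrite (dotC dK) adjP -AB -dotC.
Qed.

Lemma transposeE K (dK : {dot K for Num.conj})
    (J : {linear K -> K | Num.conj \; *:%R}) (X : 'End(K)) x :
  transpose dK J X x = J (adj dK dK X (J x)).
Proof.
rewrite /transpose; set f := fun x => _.
have linf : linear f.
  have JP c y z : J (c *: y + z) = Num.conj c *: J y + J z by exact: linearP.
  have AP c y z : adj dK dK X (c *: y + z) = c *: adj dK dK X y + adj dK dK X z.
    by exact: linearP.
  by move=> a u v; rewrite /f JP AP JP conjCK.
pose fL : {linear K -> K} := HB.pack f (GRing.isLinear.Build _ _ _ _ f linf).
by rewrite (lfunE fL).
Qed.

End Operators.

(* Main.v *)
Require Import Defs.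
From HB Require Import structures.
From mathcomp Require Import all_boot all_order all_algebra.
From mathcomp Require Import boolp reals.
From mathcomp Require Import complex.
From mathcomp Require Import ring.

Set Implicit Arguments.
Unset Strict Implicit.
Unset Printing Implicit Defensive.

Import Order.TTheory GRing.Theory Num.Theory.
Local Open Scope ring_scope.

(** Write [u><y] for the operator [z |-> <y, z> u], a dyad, so that the
    one-dimensional projections are the [x><x] with [x] a unit vector, and put
    [F x y = phi [x><y]]. The form [F] is sesquilinear, and each [F x x] is
    positive of rank at most one; since the dyads span the operators, it
    suffices to determine [F], and by polarization only its diagonal.

    The two by two minors of an operator of rank at most one vanish
    ([rank_le1_minor]). Fix a vector [x0] with [F x0 x0 <> 0], scaled so that
    [F x0 x0 = v><v] for a unit vector [v]. For every [x], the minors of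
    [F (t x + x0) (t x + x0)] vanish for all complex [t]; they are polynomials in
    [t] and its conjugate, so each coefficient vanishes ([minor_coef]). With
    [A = F x x0], the coefficient of [t ^ 2] says that on the orthogonal of [v]
    either the component of [A v] or that of [A^* v] is zero: this is the origin
    of the dichotomy between [X] and its transpose.
    - If [A v] leaves the line of [v], the other coefficients give
      [F x x = Av><Av] ([rank_one_off_line]). As soon as this happens for one
      vector [y0], put [B x = F x x0 v]; then [F x x = Bx><Bx] also holds for the
      [x] that [B] sends to the line of [v], because then [y0 + x], [y0 - x] and
      [y0] are all off the line and the parallelogram identity applies. Hence
      [phi X = B X B^*] ([rank_one_map_congruence]).
    - If [A^* v] leaves the line of [v] for some vector, the composite of [phi]
      with the transposition is in the previous case, as the transpose of [x><y]
      is [Jy><Jx] for the conjugation [J].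
    - Otherwise each [F x x] is a multiple of [v><v] ([rank_one_on_line]), and so
      is every [phi X]. *)

(** * Coefficients of polynomials in t and its conjugate *)

Section Coefficients.
Variable C : numClosedFieldType.

Lemma quartic_coef_eq0 (e0 e1 e2 e3 e4 : C) :
  (forall n : int,
     e0 + e1 * n%:~R + e2 * n%:~R ^+ 2 + e3 * n%:~R ^+ 3 + e4 * n%:~R ^+ 4 = 0) ->
  [/\ e1 = 0, e2 = 0 & e3 = 0].
Proof.
pose p (n : int) : C :=
  e0 + e1 * n%:~R + e2 * n%:~R ^+ 2 + e3 * n%:~R ^+ 3 + e4 * n%:~R ^+ 4.
move=> h; have {}h n : p n = 0 by exact: h.
(* Finite differences of [p] at 1 and 2 isolate the odd and even coefficients. *)
have n24 : (24 : C) != 0 by rewrite pnatr_eq0.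
have E1 : 24 * e1 = 16 * (p 1 - p (-1)) - 2 * (p 2 - p (-2)) by rewrite /p; ring.
have E2 : 24 * e2 = 16 * (p 1 + p (-1)) - (p 2 + p (-2)) - 30 * p 0.
  by rewrite /p; ring.
have E3 : 24 * e3 = 2 * (p 2 - p (-2)) - 4 * (p 1 - p (-1)) by rewrite /p; ring.
by split; apply: (mulfI n24); rewrite mulr0 ?E1 ?E2 ?E3 !h; ring.
Qed.

(** On each ray [t = n u] the expression is a quartic polynomial in the integer
    [n]. Its coefficients mix the [c_ij] with the same [i + j]; comparing the rays
    through [1], ['i] and [1 + 'i] separates them. *)
Lemma bidegree2_coef_eq0 (c00 c10 c01 c11 c20 c02 c21 c12 c22 : C) :
  (forall t, c00 + c10 * t + c01 * t^* + c20 * t ^+ 2 + c11 * (t * t^*)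
     + c02 * t^* ^+ 2 + c21 * (t ^+ 2 * t^*) + c12 * (t * t^* ^+ 2)
     + c22 * (t * t^*) ^+ 2 = 0) ->
  [/\ c10 = 0, c20 = 0, c11 = 0 & c21 = 0].
Proof.
move=> h.
have n2 : (2 : C) != 0 by rewrite pnatr_eq0.
have n2i : 2 * 'i != 0 :> C by rewrite mulf_neq0 ?neq0Ci.
have ray (u : C) : [/\ c10 * u + c01 * u^* = 0,
    c20 * u ^+ 2 + c11 * (u * u^*) + c02 * u^* ^+ 2 = 0
  & c21 * (u ^+ 2 * u^*) + c12 * (u * u^* ^+ 2) = 0].
  apply: (@quartic_coef_eq0 c00 _ _ _ (c22 * (u * u^*) ^+ 2)) => n.
  have nu : (n%:~R * u)^* = n%:~R * u^* :> C by rewrite rmorphM rmorph_int.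
  by rewrite -[RHS](h (n%:~R * u)) nu; ring.
have [d1 d2 d3] := ray 1; have [i1 i2 i3] := ray 'i; have [_ s2 _] := ray (1 + 'i).
move: d1 d2 d3 i1 i2 i3 s2.
rewrite rmorphD /= conjCi rmorph1.
have ii := sqrCi C.
set p1 := (X in X = 0 -> _) => d1; set p2 := (X in X = 0 -> _) => d2.
set p3 := (X in X = 0 -> _) => d3; set q1 := (X in X = 0 -> _) => i1.
set q2 := (X in X = 0 -> _) => i2; set q3 := (X in X = 0 -> _) => i3.
set r2 := (X in X = 0 -> _) => s2.
have E11 : 2 * c11 = p2 + q2 by rewrite /p2 /q2; ring: ii.
have z11 : c11 = 0 by apply: (mulfI n2); rewrite E11 d2 i2; ring.
have E10 : 2 * 'i * c10 = 'i * p1 + q1 by rewrite /p1 /q1; ring.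
have E21 : 2 * 'i * c21 = 'i * p3 + q3 by rewrite /p3 /q3; ring: ii.
have E20 : 2 * 'i * (2 * c20) = 2 * 'i * p2 + r2 - (2 + 2 * 'i) * c11.
  by rewrite /p2 /r2; ring: ii.
split=> //; apply: (mulfI n2i); rewrite mulr0.
- by rewrite E10 d1 i1; ring.
- by apply: (mulfI n2); rewrite mulrCA E20 d2 s2 z11; ring.
- by rewrite E21 d3 i3; ring.
Qed.

(** The coefficients of [t], [t ^ 2], [t t^*] and [t ^ 2 t^*], in this order, are
    those that the minors of a family of rank one operators call for. *)
Lemma bidegree1_mul_coef (a1 b1 c1 d1 a2 b2 c2 d2 a3 b3 c3 d3 a4 b4 c4 d4 : C) :
  (forall t, (a1 + b1 * t + c1 * t^* + d1 * (t * t^*))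
           * (a2 + b2 * t + c2 * t^* + d2 * (t * t^*))
           = (a3 + b3 * t + c3 * t^* + d3 * (t * t^*))
           * (a4 + b4 * t + c4 * t^* + d4 * (t * t^*))) ->
  [/\ a1 * b2 + b1 * a2 = a3 * b4 + b3 * a4,
      b1 * b2 = b3 * b4,
      a1 * d2 + d1 * a2 + b1 * c2 + c1 * b2 = a3 * d4 + d3 * a4 + b3 * c4 + c3 * b4
    & b1 * d2 + d1 * b2 = b3 * d4 + d3 * b4].
Proof.
move=> h.
have [] := @bidegree2_coef_eq0
  (a1 * a2 - a3 * a4)
  (a1 * b2 + b1 * a2 - (a3 * b4 + b3 * a4))
  (a1 * c2 + c1 * a2 - (a3 * c4 + c3 * a4))
  (a1 * d2 + d1 * a2 + b1 * c2 + c1 * b2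
     - (a3 * d4 + d3 * a4 + b3 * c4 + c3 * b4))
  (b1 * b2 - b3 * b4) (c1 * c2 - c3 * c4)
  (b1 * d2 + d1 * b2 - (b3 * d4 + d3 * b4))
  (c1 * d2 + d1 * c2 - (c3 * d4 + d3 * c4))
  (d1 * d2 - d3 * d4).
- by move=> t; have /eqP := h t; rewrite -subr_eq0 => /eqP <-; ring.
- by do 4!move/subr0_eq => ?.
Qed.

End Coefficients.

(** * Sesquilinear maps *)

Section Polarization.
Variables (C : numClosedFieldType) (U V : lmodType C).

Lemma polarization (g : U -> U -> V) :
  bilinear_for *:%R (Num.conj \; *:%R) g ->
  (forall x, g x x = 0) -> forall x y, g x y = 0.
Proof.
case=> gl gr g0 x y.
have gD a : g (a *: y + x) (a *: y + x) = a *: g y x + a^* *: g x y.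
  by rewrite gl !gr /= !g0 !scaler0 add0r addr0.
have n2 : (2 : C) != 0 by rewrite pnatr_eq0.
have E : (2 : C) *: g x y = g (1 *: y + x) (1 *: y + x)
    + 'i *: g ('i *: y + x) ('i *: y + x).
  rewrite !gD conjCi rmorph1 !scale1r scalerDr !scalerA mulrN -expr2 sqrCi opprK.
  by rewrite scaleN1r scale1r addrACA addrN add0r scaler_nat mulr2n.
by apply: (scalerI n2); rewrite E !g0 !scaler0 addr0.
Qed.

Lemma parallelogram (g : U -> U -> V) :
  bilinear_for *:%R (Num.conj \; *:%R) g ->
  forall x y, g (1 *: x + y) (1 *: x + y) + g ((-1) *: x + y) ((-1) *: x + y)
    = g x x *+ 2 + g y y *+ 2.
Proof.
case=> gl gr x y.
rewrite !gl !gr /= rmorphN !rmorph1 !scale1r !scaleN1r opprD opprK.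
rewrite [LHS]addrACA (addrACA (g x x)) addrN addr0 (addrACA (g y x)) addrN add0r.
by rewrite !mulr2n.
Qed.

End Polarization.

(** * Dyads *)

Section Dyads.
Variables (C : numClosedFieldType) (K H : vectType C).
Variables (dK : {dot K for Num.conj}) (dH : {dot H for Num.conj}).

Definition dyad (u : H) (y : K) : 'Hom(K, H) := linfun (fun z => dK z y *: u).

Lemma dyadE u y z : dyad u y z = dK z y *: u.
Proof.
have lin : linear (fun z => dK z y *: u).
  by move=> a z1 z2; rewrite linearPl scalerDl scalerA.
pose L : {linear K -> H} := HB.pack (fun z => dK z y *: u)
  (GRing.isLinear.Build _ _ _ _ _ lin).
exact: (lfunE L).
Qed.

Lemma dyad_sesquilinear : bilinear_for *:%R (Num.conj \; *:%R) dyad.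
Proof.
split=> y a u v; apply/lfunP => z; rewrite add_lfunE scale_lfunE !dyadE /=.
- by rewrite scalerDr !scalerA mulrC.
- by rewrite linearPr /= scalerDl scalerA.
Qed.

(** The Riesz representation of a functional, in the form: an operator with
    values in a line is a dyad. The vector [y] is a multiple of the image of [u]
    under the adjoint. *)
Lemma dyad_riesz (u : H) (A : 'Hom(K, H)) :
  (limg A <= <[u]>)%VS -> exists y, A = dyad u y.
Proof.
move=> /subvP imA.
have /boolp.choice[k Ak] z : exists k, A z = k *: u.
  by apply/vlineP/imA/memv_img/memvf.
have [u0|u0] := eqVneq u 0.
  by exists 0; apply/lfunP => z; rewrite dyadE Ak u0 !scaler0.
pose B := adj dK dH A.
have uu : dH u u != 0 by rewrite dnorm_eq0.
exists ((dH u u)^-1^* *: B u); apply/lfunP => z; rewrite dyadE linearZr_LR /=.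
by rewrite adjP Ak linearZl_LR /= conjCK mulrCA mulVf // mulr1.
Qed.

End Dyads.

Section DyadComposition.
Variables (C : numClosedFieldType) (K H L : vectType C).
Variables (dK : {dot K for Num.conj}) (dH : {dot H for Num.conj}).
Variables (dL : {dot L for Num.conj}).

Lemma comp_dyad (A : 'Hom(H, L)) u y :
  (A \o dyad dK u y)%VF = dyad dK (A u) y.
Proof. by apply/lfunP => z; rewrite comp_lfunE !dyadE linearZ. Qed.

Lemma dyad_comp_adj (B : 'Hom(K, L)) (u : H) y :
  (dyad dK u y \o adj dK dL B)%VF = dyad dL u (B y).
Proof.
by apply/lfunP => z; rewrite comp_lfunE !dyadE (dotC dK) adjP -dotC.
Qed.

Lemma adj_dyad (u : H) y : adj dK dH (dyad dK u y) = dyad dH y u.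
Proof.
apply: adj_unique => z w; rewrite !dyadE linearZl_LR linearZr_LR /=.
by rewrite -dotC mulrC.
Qed.

End DyadComposition.

Section Endomorphisms.
Variables (C : numClosedFieldType) (K : vectType C) (dK : {dot K for Num.conj}).

(** For a basis [e], the vector [w i] represents the [i]-th coordinate functional,
    so the identity is the sum of the [dyad (e i) (w i)]. *)
Lemma dyad_expansion : exists (n : nat) (e w : 'I_n -> K),
  forall X : 'End(K), X = \sum_(i < n) dyad dK (X (e i)) (w i).
Proof.
pose b := vbasis {:K}.
pose r (i : 'I_(\dim {:K})) : 'End(K) := linfun (fun z => coord b i z *: b`_i).
have rE i z : r i z = coord b i z *: b`_i.
  have lin : linear (fun z => coord b i z *: b`_i).
    by move=> a z1 z2; rewrite linearP scalerDl scalerA.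
  pose T : {linear K -> K} := HB.pack (fun z => coord b i z *: b`_i)
    (GRing.isLinear.Build _ _ _ _ _ lin).
  exact: (lfunE T).
have /boolp.choice[w rw] i : exists w, r i = dyad dK b`_i w.
  apply: dyad_riesz => //; apply/subvP => _ /memv_imgP[z _ ->].
  by rewrite rE memvZ ?memv_line.
exists (\dim {:K}), (fun i => b`_i), w => X; apply/lfunP => z.
rewrite {1}(coord_vbasis (memvf z)) linear_sum sum_lfunE.
by apply: eq_bigr => i _; rewrite -comp_dyad -rw comp_lfunE rE.
Qed.

Lemma eq_on_dyads (V : lmodType C) (f g : {linear 'End(K) -> V}) :
  (forall x y, f (dyad dK x y) = g (dyad dK x y)) -> f =1 g.
Proof.
move=> fg X; have [n [e [w eX]]] := dyad_expansion.
by rewrite (eX X) !linear_sum; apply: eq_bigr => i _.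
Qed.

Lemma eq_on_square_dyads (V : lmodType C) (f g : {linear 'End(K) -> V}) :
  (forall x, f (dyad dK x x) = g (dyad dK x x)) -> f =1 g.
Proof.
move=> fg; apply: eq_on_dyads => x y; apply/subr0_eq.
pose h x y := f (dyad dK x y) - g (dyad dK x y).
suff hs : bilinear_for *:%R (Num.conj \; *:%R) h.
  by apply: (polarization hs) => {}x; rewrite /h fg subrr.
have [dl dr] := @dyad_sesquilinear C K K dK.
split=> u a v w; rewrite /h.
- by rewrite (dl u a v w) (linearP f) (linearP g) /= opprD addrACA scalerBr.
- by rewrite (dr u a v w) (linearP f) (linearP g) /= opprD addrACA scalerBr.
Qed.

End Endomorphisms.

(** * Positive operators of rank at most one *)

Section PositiveOperators.
Variables (C : numClosedFieldType) (H : vectType C) (dH : {dot H for Num.conj}).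

Lemma normalize_dyad x : x != 0 ->
  exists v, dH v v = 1 /\ dyad dH x x = dH x x *: dyad dH v v.
Proof.
move=> x0; have s0 : 0 < dH x x by rewrite dnorm_gt0.
pose c := sqrtC (dH x x); have c0 : 0 < c by rewrite sqrtC_gt0.
have cc : c * c = dH x x by rewrite -expr2 sqrtCK.
have cconj : c^-1^* = c^-1 by rewrite geC0_conj // invr_ge0 ltW.
exists (c^-1 *: x); split.
  rewrite linearZl_LR linearZr_LR /= cconj mulrA -invfM cc mulVf //.
  by rewrite gt_eqF.
apply/lfunP => z; rewrite scale_lfunE !dyadE linearZr_LR /= cconj !scalerA.
by rewrite -cc; congr (_ *: _); field; rewrite gt_eqF.
Qed.

Lemma unit_dyad_projection v : dH v v = 1 ->
  one_dim_projection dH (dyad dH v v).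
Proof.
move=> v1; have v0 : v != 0 by rewrite -(dnorm_eq0 dH) v1 oner_eq0.
have Qv : dyad dH v v v = v by rewrite dyadE v1 scale1r.
split; first by split; rewrite ?comp_dyad ?Qv ?adj_dyad.
suff -> : rank (dyad dH v v) = \dim <[v]> by rewrite dim_vline v0.
congr (\dim _); apply/eqP; rewrite eqEsubv; apply/andP; split.
  by apply/subvP => _ /memv_imgP[z _ ->]; rewrite dyadE memvZ ?memv_line.
by rewrite -memvE -{1}Qv memv_img ?memvf.
Qed.

(** A positive operator is self-adjoint, because its quadratic form is real and
    polarization recovers the sesquilinear form. *)
Lemma positive_op_herm (T : 'End(H)) : positive_op dH T ->
  forall z w, dH (T z) w = (dH (T w) z)^*.
Proof.
move=> Tpos z w; apply/subr0_eq.
pose h z w : C^o := dH (T z) w - (dH (T w) z)^*.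
suff hs : bilinear_for *:%R (Num.conj \; *:%R) h.
  by apply: (polarization hs) => {}z; rewrite /h geC0_conj ?subrr.
split=> y a u v; rewrite /h (linearP T) ?linearPl ?linearPr /= rmorphD rmorphM /=.
- by rewrite conjCK /GRing.scale /=; ring.
- by rewrite /GRing.scale /=; ring.
Qed.

(** The two by two minor on the rows [v, z] and the columns [v, w]; unlike the
    rank, it is polynomial in [T]. *)
Lemma rank_le1_minor (T : 'End(H)) : (rank T <= 1)%N ->
  forall v z w, dH (T v) v * dH (T z) w = dH (T v) w * dH (T z) v.
Proof.
rewrite /rank => rT v z w.
have [q /subvP Tq] : exists q, (limg T <= <[q]>)%VS.
  exists (vpick (limg T)).
  have [->|T0] := eqVneq (limg T) 0%VS; first by rewrite sub0v.
  have q0 : vpick (limg T) != 0 by rewrite vpick0.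
  rewrite -(geq_leqif (dimv_leqif_sup _)) ?dim_vline ?q0 //.
  by rewrite -memvE memv_pick.
have /vlineP[a ->] := Tq _ (memv_img T (memvf v)).
have /vlineP[b ->] := Tq _ (memv_img T (memvf z)).
by rewrite !linearZl_LR /=; ring.
Qed.

(** If [<u, T u> <> 0], the minors through [u] read
    [<u, T u> T = Tu><Tu], which is normalized to a unit vector. *)
Lemma positive_rank_le1_dyad (T : 'End(H)) :
  positive_op dH T -> (rank T <= 1)%N -> T != 0 ->
  exists c v, [/\ 0 < c, dH v v = 1 & c *: T = dyad dH v v].
Proof.
move=> Tpos Trank T0; have Tmin := rank_le1_minor Trank.
have herm := positive_op_herm Tpos.
have [u uT] : exists u, dH (T u) u != 0.
  apply: contrapT => noT; move/eqP: T0; apply; apply/lfunP => z.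
  rewrite zero_lfunE; apply: (dot_inj (dK := dH)) => w; rewrite linear0l.
  have Tzz : dH (T z) z = 0 by apply: contrapT => /eqP ?; apply: noT; exists z.
  have /esym/eqP := Tmin z w w.
  by rewrite Tzz mul0r (herm w) mul_conjC_eq0 => /eqP.
have Tu0 : T u != 0 by apply: contraNneq uT => ->; rewrite linear0l.
have [v [v1 Tv]] := normalize_dyad Tu0.
exists (dH (T u) u / dH (T u) (T u)), v; split=> //.
  by rewrite divr_gt0 ?dnorm_gt0 // lt_def uT Tpos.
have s0 : dH (T u) (T u) != 0 by rewrite dnorm_eq0.
apply: (scalerI s0); rewrite -Tv scalerA mulrC divfK //.
apply/lfunP => z; apply: (dot_inj (dK := dH)) => w.
rewrite scale_lfunE dyadE !linearZl_LR /= Tmin (herm z u).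
by rewrite mulrC -dotC.
Qed.

Lemma eq0_on_orthogonal_split (T : 'End(H)) v : dH v v = 1 ->
  dH (T v) v = 0 ->
  (forall w, dH v w = 0 -> dH (T v) w = 0 /\ dH (T w) v = 0) ->
  (forall z w, dH v z = 0 -> dH v w = 0 -> dH (T z) w = 0) ->
  T = 0.
Proof.
move=> v1 Tvv Tv Tvo.
have decomp z : exists z', dH v z' = 0 /\ z = dH z v *: v + z'.
  exists (z - dH z v *: v); rewrite subrKC; split=> //.
  by rewrite linearBr linearZr_LR /= v1 mulr1 -dotC subrr.
apply/lfunP => z; rewrite zero_lfunE; apply: (dot_inj (dK := dH)) => w.
have [z' [z'v ->]] := decomp z; have [w' [w'v ->]] := decomp w.
have [Tvw' _] := Tv _ w'v; have [_ Tz'v] := Tv _ z'v.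
rewrite linear0l (linearP T) linearPl !linearDr !linearZr_LR /=.
by rewrite Tvv Tvw' Tz'v Tvo // !(mulr0, addr0).
Qed.

End PositiveOperators.

(** * Maps sending the dyads of single vectors to rank one operators *)

Section RankOneMaps.
Variables (C : numClosedFieldType) (K H : vectType C).
Variables (dK : {dot K for Num.conj}) (dH : {dot H for Num.conj}).
Implicit Type phi : {linear 'End(K) -> 'End(H)}.

(** This weakening of positivity, which constrains [phi] on the dyads [x><x]
    only, is visibly inherited by the composite of [phi] with a transposition. *)
Definition rank_one_map phi : Prop := forall x,
  positive_op dH (phi (dyad dK x x)) /\ (rank (phi (dyad dK x x)) <= 1)%N.

Lemma linear_dyad_sesquilinear phi :
  bilinear_for *:%R (Num.conj \; *:%R) (fun x y => phi (dyad dK x y)).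
Proof.
have [dl dr] := @dyad_sesquilinear C K K dK.
by split=> y a u v /=; rewrite ?(dl y a u v) ?(dr y a u v) linearP.
Qed.

Lemma positive_rank_one_map phi : positive_map dK dH phi ->
  (forall P, one_dim_projection dK P -> (rank (phi P) <= 1)%N) ->
  rank_one_map phi.
Proof.
move=> phi_pos phi_rank x; split.
  apply: phi_pos => z; rewrite dyadE linearZl_LR /= [X in _ * X](dotC dK).
  by rewrite mul_conjC_ge0.
have [->|x0] := eqVneq x 0.
  have -> : dyad dK 0 0 = 0 :> 'End(K).
    by apply/lfunP => z; rewrite dyadE scaler0 zero_lfunE.
  by rewrite linear0 /rank lim0g dimv0.
have [v [v1 ->]] := normalize_dyad dK x0.
apply: leq_trans (phi_rank _ (unit_dyad_projection v1)).
apply/dimvS/subvP => _ /memv_imgP[z _ ->].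
by rewrite linearZ scale_lfunE /= memvZ ?memv_img ?memvf.
Qed.

Section FixedMap.
Variable phi : {linear 'End(K) -> 'End(H)}.
Hypothesis phi1 : rank_one_map phi.

Local Notation f x y z w := (dH (phi (dyad dK x y) z) w).

Lemma rank_one_map_minor x v z w :
  f x x v v * f x x z w = f x x v w * f x x z v.
Proof. by apply: rank_le1_minor; case: (phi1 x). Qed.

Lemma rank_one_map_herm x y z w : f x y z w = (f y x w z)^*.
Proof.
apply/subr0_eq; pose h x y : C^o := f x y z w - (f y x w z)^*.
suff hs : bilinear_for *:%R (Num.conj \; *:%R) h.
  apply: (polarization hs) => {}x; rewrite /h (positive_op_herm (proj1 (phi1 x))).
  by rewrite subrr.
have [dl dr] := linear_dyad_sesquilinear phi.
split=> u a x1 x2; rewrite /h dl dr !add_lfunE !scale_lfunE;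
  rewrite !linearDl !linearZl_LR /=.
- by rewrite rmorphD rmorphM /= conjCK /GRing.scale /=; ring.
- by rewrite rmorphD rmorphM /= /GRing.scale /=; ring.
Qed.

Lemma form_dyad_line x0 x t z w :
  f (t *: x + x0) (t *: x + x0) z w
    = f x0 x0 z w + f x x0 z w * t + f x0 x z w * t^* + f x x z w * (t * t^*).
Proof.
have [dl dr] := linear_dyad_sesquilinear phi.
rewrite dl !dr /= !(add_lfunE, scale_lfunE, linearDl, linearZl_LR) /=.
by ring.
Qed.

Section BasePoint.
Variables (x0 : K) (v : H).
Hypothesis v1 : dH v v = 1.
Hypothesis phix0 : phi (dyad dK x0 x0) = dyad dH v v.

(** Coefficients of the minors of [phi] along the line [t x + x0]. For [z] and
    [w] orthogonal to [v], the only nonzero entry of [phi (dyad x0 x0)] in these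
    minors is the one at [v, v], which leaves short identities. *)
Lemma minor_coef x z w : dH v z = 0 -> dH v w = 0 ->
  [/\ f x x0 z w = 0, f x x0 v w * f x x0 z v = 0,
      f x x z w = f x x0 v w * f x0 x z v + f x0 x v w * f x x0 z v
    & f x x0 v v * f x x z w = f x x0 v w * f x x z v + f x x v w * f x x0 z v].
Proof.
have coef z' w' : dH v z' = 0 -> dH v w' = 0 ->
  [/\ f x x0 z' w' = 0, f x x0 v w' * f x x0 z' v = 0,
      f x x z' w' + f x x0 v v * f x0 x z' w'
        = f x x0 v w' * f x0 x z' v + f x0 x v w' * f x x0 z' v
    & f x x0 v v * f x x z' w' + f x x v v * f x x0 z' w'
        = f x x0 v w' * f x x z' v + f x x v w' * f x x0 z' v].
  move=> vz' vw'; have z'v : dH z' v = 0 by rewrite dotC vz' conjC0.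
  have f0 z1 w1 : f x0 x0 z1 w1 = dH z1 v * dH v w1.
    by rewrite phix0 dyadE linearZl_LR.
  have [] := @bidegree1_mul_coef _
    (f x0 x0 v v) (f x x0 v v) (f x0 x v v) (f x x v v)
    (f x0 x0 z' w') (f x x0 z' w') (f x0 x z' w') (f x x z' w')
    (f x0 x0 v w') (f x x0 v w') (f x0 x v w') (f x x v w')
    (f x0 x0 z' v) (f x x0 z' v) (f x0 x z' v) (f x x z' v).
    by move=> t; rewrite -!form_dyad_line; exact: rank_one_map_minor.
  rewrite !f0 v1 z'v vw' !(mul0r, mulr0, mul1r, addr0, add0r) => f10 <- f11 f21.
  split; [exact: f10 | by rewrite f10 mulr0 | | exact: f21].
  by rewrite -f11 f10 mulr0 addr0.
move=> vz vw; have [f10 f10M f11 f21] := coef z w vz vw.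
have [f10' _ _ _] := coef w z vw vz.
move: f11 f21; rewrite (rank_one_map_herm x0 x z w) f10' f10 conjC0.
by rewrite !mulr0 !addr0.
Qed.

(** As [a] has a component along [w0], the second identity of [minor_coef] makes
    the corresponding component of [phi (dyad x0 x) v] vanish, and the remaining
    ones give the entries of [phi (dyad x x)] one block at a time in the
    decomposition into the line of [v] and its orthogonal. *)
Lemma rank_one_off_line x w0 : dH v w0 = 0 -> f x x0 v w0 != 0 ->
  let a := phi (dyad dK x x0) v in phi (dyad dK x x) = dyad dH a a.
Proof.
move=> vw0 aw0 a.
have f01E z w : f x0 x z w = (f x x0 w z)^* by exact: rank_one_map_herm.
have az0 z : dH v z = 0 -> f x x0 z v = 0.
  move=> vz; have [_ /eqP] := minor_coef x vz vw0.
  by rewrite mulf_eq0 (negbTE aw0) => /eqP.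
have f11 z w : dH v z = 0 -> dH v w = 0 -> f x x z w = dH a w * (dH a z)^*.
  move=> vz vw; have [_ _ -> _] := minor_coef x vz vw.
  by rewrite az0 // mulr0 addr0 f01E.
have f11v z : dH v z = 0 -> f x x z v = dH a v * (dH a z)^*.
  move=> vz; have [_ _ _] := minor_coef x vz vw0.
  by rewrite (f11 z w0) // (az0 z) // mulr0 addr0 mulrCA => /(mulfI aw0).
have f11v' z : dH v z = 0 -> f x x v z = (dH a v)^* * dH a z.
  by move=> vz; rewrite rank_one_map_herm f11v // rmorphM /= conjCK.
(* The corner entry comes from the minors of [phi (dyad x x)] itself. *)
have f11vv : f x x v v = dH a v * (dH a v)^*.
  have := rank_one_map_minor x v w0 w0.
  rewrite (f11 w0 w0) // (f11v w0) // (f11v' w0) // => e.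
  apply: (mulIf (x := dH a w0 * (dH a w0)^*)).
    by rewrite mulf_neq0 ?conjC_eq0.
  by rewrite e; ring.
apply/subr0_eq; apply: (eq0_on_orthogonal_split v1).
- rewrite add_lfunE opp_lfunE dyadE linearDl linearNl linearZl_LR /=.
  by rewrite f11vv (dotC dH v a); ring.
- move=> w vw.
  split; rewrite add_lfunE opp_lfunE dyadE linearDl linearNl linearZl_LR /=.
    by rewrite f11v' // (dotC dH v a); ring.
  by rewrite f11v // (dotC dH w a); ring.
- move=> z w vz vw.
  rewrite add_lfunE opp_lfunE dyadE linearDl linearNl linearZl_LR /=.
  by rewrite f11 // (dotC dH z a); ring.
Qed.

(** The third identity of [minor_coef] leaves no entry on the orthogonal of [v];
    a Hermitian operator of rank at most one with a zero diagonal entry has a zero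
    row there. *)
Lemma rank_one_on_line x :
  (forall w, dH v w = 0 -> f x x0 v w = 0 /\ f x0 x v w = 0) ->
  phi (dyad dK x x) = f x x v v *: dyad dH v v.
Proof.
move=> x_line; have f11 z w : dH v z = 0 -> dH v w = 0 -> f x x z w = 0.
  move=> vz vw; have [_ _ -> _] := minor_coef x vz vw.
  by have [-> ->] := x_line _ vw; rewrite !mul0r addr0.
have f11v w : dH v w = 0 -> f x x v w = 0.
  move=> vw; have /esym/eqP := rank_one_map_minor x v w w.
  by rewrite (f11 w w) // mulr0 (rank_one_map_herm x x w v) mul_conjC_eq0 => /eqP.
apply/subr0_eq; apply: (eq0_on_orthogonal_split v1).
- rewrite add_lfunE opp_lfunE scale_lfunE dyadE v1 scale1r.
  rewrite linearDl linearNl linearZl_LR /= v1.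
  by rewrite mulr1 subrr.
- move=> w vw; have wv : dH w v = 0 by rewrite dotC vw conjC0.
  split; rewrite add_lfunE opp_lfunE scale_lfunE dyadE;
    rewrite linearDl linearNl !linearZl_LR /=.
    by rewrite f11v // vw !mulr0 subrr.
  by rewrite rank_one_map_herm f11v // wv conjC0 !(mul0r, mulr0) subrr.
- move=> z w vz vw; rewrite add_lfunE opp_lfunE scale_lfunE dyadE.
  rewrite linearDl linearNl !linearZl_LR /=.
  by rewrite f11 // vw !mulr0 subrr.
Qed.

(** If [phi X = B X B^*], then [phi (dyad x x0) (B x0)] is a multiple of [B x];
    hence the choice of [B] as [x |-> phi (dyad x x0) v]. *)
Lemma rank_one_map_congruence y0 w0 : dH v w0 = 0 -> f y0 x0 v w0 != 0 ->
  exists B : 'Hom(K, H), forall X, phi X = (B \o X \o adj dK dH B)%VF.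
Proof.
move=> vw0 y0w0; have [dl dr] := linear_dyad_sesquilinear phi.
pose b x := phi (dyad dK x x0) v.
have lin : linear b.
  by move=> a x y; rewrite /b dl add_lfunE scale_lfunE.
pose bL : {linear K -> H} := HB.pack b (GRing.isLinear.Build _ _ _ _ b lin).
pose B : 'Hom(K, H) := linfun bL.
have BE x : B x = b x by exact: (lfunE bL).
pose G x y := phi (dyad dK x y) - dyad dH (B x) (B y).
have Gs : bilinear_for *:%R (Num.conj \; *:%R) G.
  have [bl br] := @dyad_sesquilinear C H H dH.
  split=> y a u u'; rewrite /G (linearP B).
  - by rewrite dl (bl _ a) opprD addrACA -scalerBr.
  - by rewrite dr (br _ a) opprD addrACA -scalerBr.
have G_off x : f x x0 v w0 != 0 -> G x x = 0.
  by move=> xw0; rewrite /G (rank_one_off_line vw0 xw0) BE subrr.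
have G0 x : G x x = 0.
  have [xw0|] := eqVneq (f x x0 v w0) 0; last exact: G_off.
  (* Adding a multiple of [x] to [y0] does not change the component along [w0],
     so both vectors of the parallelogram are covered by [G_off]. *)
  have off c : G (c *: x + y0) (c *: x + y0) = 0.
    apply: G_off; rewrite dl add_lfunE scale_lfunE linearDl linearZl_LR /=.
    by rewrite xw0 mulr0 add0r.
  have n2 : (2 : C) != 0 by rewrite pnatr_eq0.
  apply: (scalerI n2); rewrite scaler0 scaler_nat.
  have := parallelogram Gs x y0.
  by rewrite !off (G_off _ y0w0) mul0rn !addr0.
exists B => X; have [n [e [w eX]]] := dyad_expansion dK.
rewrite (eX X) linear_sum; apply/lfunP => z.
rewrite !comp_lfunE !sum_lfunE linear_sum; apply: eq_bigr => i _ /=.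
rewrite -comp_lfunE -comp_lfunE comp_dyad dyad_comp_adj.
by congr (fun_of_lfun _ _); apply/subr0_eq/(polarization Gs).
Qed.

End BasePoint.
End FixedMap.
End RankOneMaps.

(** * Transposition *)

Section Transpose.
Variables (C : numClosedFieldType) (K H : vectType C).
Variables (dK : {dot K for Num.conj}) (dH : {dot H for Num.conj}).
Variable J : {linear K -> K | Num.conj \; *:%R}.
Hypothesis hJ : is_conjugation dK J.

Lemma transpose_linear : linear (transpose dK J).
Proof.
move=> a X Y; apply/lfunP => z; rewrite add_lfunE scale_lfunE !transposeE.
have -> : adj dK dK (a *: X + Y) = a^* *: adj dK dK X + adj dK dK Y.
  apply: adj_unique => x y; rewrite !add_lfunE !scale_lfunE linearPr linearPl /=.
  by rewrite conjCK !adjP.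
by rewrite add_lfunE scale_lfunE linearP /= conjCK.
Qed.

Lemma transpose_dyad x y :
  transpose dK J (dyad dK x y) = dyad dK (J y) (J x).
Proof.
have [JK dJ] := hJ; apply/lfunP => z; rewrite transposeE adj_dyad !dyadE.
by rewrite linearZ /= -[in LHS](JK x) dJ -dotC.
Qed.

Lemma transposeK : involutive (transpose dK J).
Proof.
have [JK _] := hJ.
pose tr : {linear 'End(K) -> 'End(K)} := HB.pack (transpose dK J)
  (GRing.isLinear.Build _ _ _ _ _ transpose_linear).
apply: (eq_on_dyads (dK := dK) (f := tr \o tr) (g := idfun)) => x y.
by rewrite /= !transpose_dyad !JK.
Qed.

End Transpose.

(** * Classification *)

Section Classification.
Variables (C : numClosedFieldType) (K H : vectType C).
Variables (dK : {dot K for Num.conj}) (dH : {dot H for Num.conj}).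
Variable J : {linear K -> K | Num.conj \; *:%R}.
Hypothesis hJ : is_conjugation dK J.

Lemma scalar_valued_form (phi : {linear 'End(K) -> 'End(H)}) v :
  positive_map dK dH phi -> dH v v = 1 ->
  (forall x, phi (dyad dK x x) =
     dH (phi (dyad dK x x) v) v *: dyad dH v v) ->
  exists (omega : {scalar 'End(K)}) (Q : 'End(H)),
     [/\ positive_functional dK omega, one_dim_projection dH Q
       & forall X : 'End(K), phi X = omega X *: Q].
Proof.
move=> phi_pos v1 phiE; pose w X := dH (phi X v) v.
have wlin : GRing.linear_for *%R w.
  by move=> a X Y; rewrite /w (linearP phi) add_lfunE scale_lfunE linearPl.
pose omega : {scalar 'End(K)} := HB.pack w (GRing.isLinear.Build _ _ _ _ _ wlin).
have glin : linear (fun X => omega X *: dyad dH v v).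
  by move=> a X Y; rewrite linearP scalerDl scalerA.
pose g : {linear 'End(K) -> 'End(H)} := HB.pack
  (fun X => omega X *: dyad dH v v) (GRing.isLinear.Build _ _ _ _ _ glin).
exists omega, (dyad dH v v); split.
- by move=> X Xpos; exact: phi_pos.
- exact: unit_dyad_projection.
- exact: (eq_on_square_dyads (dK := dK) (g := g)).
Qed.

Theorem rank_one_positive_map_classification
    (phi : {linear 'End(K) -> 'End(H)}) :
  positive_map dK dH phi ->
  (forall P : 'End(K), one_dim_projection dK P -> (rank (phi P) <= 1)%N) ->
  (exists (omega : {scalar 'End(K)}) (Q : 'End(H)),
     [/\ positive_functional dK omega, one_dim_projection dH Q
       & forall X : 'End(K), phi X = omega X *: Q])
  \/ (exists B : 'Hom(K, H),
        forall X : 'End(K), phi X = (B \o X \o adj dK dH B)%VF)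
  \/ (exists C : 'Hom(K, H),
        forall X : 'End(K), phi X = (C \o transpose dK J X \o adj dK dH C)%VF).
Proof.
move=> phi_pos phi_rank; have phi1 := positive_rank_one_map phi_pos phi_rank.
have [JK _] := hJ.
have [[x phix]|phi0] := pselect (exists x, phi (dyad dK x x) != 0); last first.
  right; left; exists 0 => X; rewrite !comp_lfun0l.
  apply: (eq_on_square_dyads (dK := dK) (g := \0)) => x.
  by apply: contrapT => /eqP phix; apply: phi0; exists x.
have [pos rk] := phi1 x.
have [c [v [c0 v1 phiv]]] := positive_rank_le1_dyad pos rk phix.
pose x0 := sqrtC c *: x.
have phix0 : phi (dyad dK x0 x0) = dyad dH v v.
  have -> : dyad dK x0 x0 = c *: dyad dK x x.
    apply/lfunP => z; rewrite scale_lfunE !dyadE linearZr_LR /= !scalerA.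
    by rewrite geC0_conj ?sqrtC_ge0 ?ltW // mulrAC -expr2 sqrtCK.
  by rewrite linearZ.
have [[y [w [vw yw]]]|noB] := pselect (exists y w, dH v w = 0 /\
    dH (phi (dyad dK y x0) v) w != 0).
  by right; left; exact: (rank_one_map_congruence phi1 v1 phix0 vw yw).
have [[y [w [vw yw]]]|noC] := pselect (exists y w, dH v w = 0 /\
    dH (phi (dyad dK x0 y) v) w != 0).
  right; right.
  pose tr : {linear 'End(K) -> 'End(K)} := HB.pack (transpose dK J)
    (GRing.isLinear.Build _ _ _ _ _ (transpose_linear dK J)).
  pose psi : {linear 'End(K) -> 'End(H)} := phi \o tr.
  have psiE y1 y2 : psi (dyad dK y1 y2) = phi (dyad dK (J y2) (J y1)).
    by rewrite /psi /= transpose_dyad.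
  have psi1 : rank_one_map dK dH psi by move=> z; rewrite psiE; exact: phi1.
  have psix0 : psi (dyad dK (J x0) (J x0)) = dyad dH v v by rewrite psiE !JK.
  have yw' : dH (psi (dyad dK (J y) (J x0)) v) w != 0 by rewrite psiE !JK.
  have [B psiB] := rank_one_map_congruence psi1 v1 psix0 vw yw'.
  by exists B => X; rewrite -psiB /psi /= transposeK.
left; apply: (scalar_valued_form phi_pos v1) => y.
apply: (rank_one_on_line phi1 v1 phix0) => w vw.
split; apply: contrapT => /eqP yw; [apply: noB | apply: noC]; by exists y, w.
Qed.

End Classification.

Theorem theorem2p2 (R : realType) (K H : vectType R[i])
    (dK : {dot K for Num.conj}) (dH : {dot H for Num.conj})
    (J : {linear K -> K | Num.conj \; *:%R}) (hJ : is_conjugation dK J)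
    (phi : {linear 'End(K) -> 'End(H)})
    (phi_pos : positive_map dK dH phi)
    (phi_rank : forall P : 'End(K), one_dim_projection dK P ->
                  (rank (phi P) <= 1)%N) :
  (exists (omega : {scalar 'End(K)}) (Q : 'End(H)),
     [/\ positive_functional dK omega, one_dim_projection dH Q
       & forall X : 'End(K), phi X = omega X *: Q])
  \/ (exists B : 'Hom(K, H),
        forall X : 'End(K), phi X = (B \o X \o adj dK dH B)%VF)
  \/ (exists C : 'Hom(K, H),
        forall X : 'End(K), phi X = (C \o transpose dK J X \o adj dK dH C)%VF).
Proof. exact: rank_one_positive_map_classification hJ phi phi_pos phi_rank. Qed.
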